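(* Any flip process has at least one fixed point: for every $k\in\mathbb{N}$ and every rule $\mathcal{R}$ of order $k$ there exists a graphon $W\in\mathcal{W}_0$ with $\mathfrak{V}_{\mathcal{R}}W=0$ (equivalently, whose trajectory satisfies $\Phi^tW=W$ for all $t$).
   Context: $(\Omega,\pi)$ is a fixed atomless probability space whose sigma-algebra is separable (there is a countable family $\mathcal{C}$ of measurable sets such that for every measurable $S$ and $\delta>0$ some $T\in\mathcal{C}$ has $\pi(S\ominus T)<\delta$). $\mathcal{W}$ is the Banach space of kernels: bounded measurable functions $W:\Omega^2\to\mathbb{R}$ with $W(x,y)=W(y,x)$ a.e., identified when equal a.e., with the $L^\infty$-norm $\|\cdot\|_\infty$. $\mathcal{W}_0\subset\mathcal{W}$ is the set of graphons: kernels with values in $[0,1]$ a.e. $\mathcal{H}_k$ is the set of all (simple, labelled) graphs on vertex set $[k]$. A rule of order $k$ (defining a flip process) is a matrix $\mathcal{R}\in[0,1]^{\mathcal{H}_k\times\mathcal{H}_k}$ with $\sum_{J}\mathcal{R}_{H,J}=1$ for every $H\in\mathcal{H}_k$. For $F\in\mathcal{H}_k$, distinct $a,b\in[k]$ and $W\in\mathcal{W}$ define $$(T_F^{a,b}W)(x,y)=\int\prod_{ij\in E(F)}W(x_i,x_j)\prod_{ij\notin E(F)}(1-W(x_i,x_j))\prod_{i\in[k]\setminus\{a,b\}}\pi(\mathrm{d}x_i),\quad x_a=x,\ x_b=y,$$ where $ij$ ranges over unordered pairs of distinct elements of $[k]$. The velocity operator is $$\mathfrak{V}_{\mathcal{R}}W=\sum_{F,H\in\mathcal{H}_k}\mathcal{R}_{F,H}\sum_{1\le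 a\ne b\le k}T_F^{a,b}W\cdot\left(\mathbb{I}_{\{ab\in E(H)\setminus E(F)\}}-\mathbb{I}_{\{ab\in E(F)\setminus E(H)\}}\right),$$ the inner sum being over ordered pairs. The trajectory $t\mapsto\Phi^tW$ of a graphon $W$ is the unique maximal solution of $\frac{\mathrm{d}}{\mathrm{d}t}\Phi^tW=\mathfrak{V}_{\mathcal{R}}\Phi^tW$, $\Phi^0W=W$ (derivative with respect to $\|\cdot\|_\infty$). A fixed point is a graphon at which the trajectory stays constant. *)

(* Defs.v *)
From HB Require Import structures.
From mathcomp Require Import all_boot all_order all_algebra.
From mathcomp Require Import all_classical all_reals all_analysis.

Set Implicit Arguments.
Unset Strict Implicit.
Unset Printing Implicit Defensive.

Import Order.TTheory GRing.Theory Num.Theory.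
Import numFieldNormedType.Exports.

Local Open Scope classical_set_scope.
Local Open Scope ring_scope.

Definition atomless (d : measure_display) (T : measurableType d) (R : realType)
    (P : probability T R) : Prop :=
  forall A : set T, measurable A -> (0 < P A)%E ->
    exists B : set T, [/\ measurable B, B `<=` A & (0 < P B < P A)%E].

Definition separable_sigma_algebra (d : measure_display) (T : measurableType d)
    (R : realType) (P : probability T R) : Prop :=
  exists C : set (set T),
    [/\ countable C,
        C `<=` measurable &
        forall S : set T, measurable S -> forall e : R, 0 < e ->
          exists2 U : set T, C U & (P (S `+` U) < e%:E)%E].

(** Simple graphs on the vertex set ['I_k], as sets of two-element subsets. *)

Definition simple_graph (k : nat) : Type :=
  {E : {set {set 'I_k}} | [forall e in E, #|e| == 2]}.

Definition edges (k : nat) (F : simple_graph k) : {set {set 'I_k}} := val F.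

Definition is_rule (R : realType) (k : nat)
    (rule : simple_graph k -> simple_graph k -> R) : Prop :=
  (forall F H, 0 <= rule F H <= 1) /\ (forall F, \sum_H rule F H = 1).

Section FlipProcess.
Context (d : measure_display) (T : measurableType d) (R : realType).
Variable P : probability T R.

(** Elements of the Banach space of kernels are represented by functions,
    equality in that space being [_ = _ %[ae P \x P]]. *)

Definition is_kernel (W : T * T -> R) : Prop :=
  [/\ measurable_fun [set: T * T] W,
      exists M : R, forall z, `|W z| <= M &
      W = (fun z => W (z.2, z.1)) %[ae (P \x P)%E]].

Definition is_graphon (W : T * T -> R) : Prop :=
  is_kernel W /\ {ae (P \x P)%E, forall z, 0 <= W z <= 1}.

Definition Linfty_norm (f : T * T -> R) : \bar R :=
  'N[(P \x P)%E]_+oo[EFin \o f].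

(** Iterated integral of [g] over the variables listed in [s], the others being
    fixed by [x].  It is only used for bounded measurable integrands, for which
    it is the integral against the product measure, by Fubini. *)
Fixpoint iterated_integral (k : nat) (s : seq 'I_k) (g : ('I_k -> T) -> R)
    (x : 'I_k -> T) : R :=
  if s is i :: s' then
    \int[P]_z iterated_integral s' g (fun j => if j == i then z else x j)
  else g x.

(** Every unordered pair [ij] is represented by [i < j]; as [W] is symmetric
    almost everywhere, the choice only changes [T_op] on a null set. *)
Definition edge_product (k : nat) (F : simple_graph k) (W : T * T -> R)
    (x : 'I_k -> T) : R :=
  \prod_(i < k) \prod_(j < k | (i < j)%N)
    (if [set i; j]%SET \in edges F then W (x i, x j) else 1 - W (x i, x j)).

(** The coordinates other than [a] and [b] of the base point are overwritten
    by the integration. *)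
Definition T_op (k : nat) (F : simple_graph k) (a b : 'I_k) (W : T * T -> R)
    (z : T * T) : R :=
  iterated_integral [seq i <- enum 'I_k | i \notin [:: a; b]]
    (edge_product F W) (fun i => if i == a then z.1 else z.2).

Definition velocity (k : nat) (rule : simple_graph k -> simple_graph k -> R)
    (W : T * T -> R) (z : T * T) : R :=
  \sum_(F : simple_graph k) \sum_(H : simple_graph k) rule F H *
    \sum_(a < k) \sum_(b < k | a != b)
      T_op F a b W z *
      (([set a; b]%SET \in edges H :\: edges F)%:R
       - ([set a; b]%SET \in edges F :\: edges H)%:R).

(** [phi] solves the flow equation on the open interval [I] from time [0] at
    [W]; the values of [phi] outside [I] are irrelevant. *)
Definition is_solution (k : nat) (rule : simple_graph k -> simple_graph k -> R)
    (W : T * T -> R) (I : set R) (phi : R -> T * T -> R) : Prop :=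
  [/\ [/\ open I, is_interval I & I 0],
      forall t, I t -> is_kernel (phi t),
      phi 0 = W %[ae (P \x P)%E] &
      forall t, I t ->
        Linfty_norm (fun z => h^-1 * (phi (t + h) z - phi t z)
                              - velocity rule (phi t) z)
          @[h --> 0^'] --> 0%E].

(** The unique maximal solution: it extends every other solution. *)
Definition is_trajectory (k : nat) (rule : simple_graph k -> simple_graph k -> R)
    (W : T * T -> R) (I : set R) (phi : R -> T * T -> R) : Prop :=
  is_solution rule W I phi /\
  forall (J : set R) (psi : R -> T * T -> R), is_solution rule W J psi ->
    J `<=` I /\ forall t, J t -> psi t = phi t %[ae (P \x P)%E].

Definition is_fixed_point (k : nat)
    (rule : simple_graph k -> simple_graph k -> R) (W : T * T -> R) : Prop :=
  is_graphon W /\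
  exists2 phi : R -> T * T -> R, is_trajectory rule W [set: R] phi &
    forall t, phi t = W %[ae (P \x P)%E].

End FlipProcess.

(* Main.v *)
(** The velocity of a constant graphon [c] is a constant function, polynomial in
    [c].  At [c = 0] only edgeless graphs are sampled, so edges can only be added
    and the polynomial is nonnegative; at [c = 1] it is nonpositive.  By the
    intermediate value theorem it vanishes at some [c] in [[0, 1]].  That the
    constant solution is the maximal trajectory amounts to uniqueness of
    solutions, which follows by Gronwall's argument for the [L^oo] distance to
    [c], because the velocity is Lipschitz at [c] on bounded sets of kernels. *)

Require Import Defs.
From mathcomp Require Import all_boot all_order all_algebra.
From mathcomp Require Import all_classical all_reals all_analysis.
From mathcomp Require Import measurable_realfun ess_sup_inf ring lra.

Set Implicit Arguments.
Unset Strict Implicit.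
Unset Printing Implicit Defensive.

Import Order.TTheory GRing.Theory Num.Theory.
Import numFieldNormedType.Exports.

Local Open Scope classical_set_scope.
Local Open Scope ring_scope.

(** * Null sets of the product measure, and integrals of almost constant functions *)

Section product_ae.
Context (d : measure_display) (T : measurableType d) (R : realType).
Variable P : probability T R.

(** The measure of a swapped set is the integral of the sections of the original set in the other
    direction. That integral also defines the product measure, by uniqueness on rectangles. *)
Lemma ae_swap (Q : T * T -> Prop) :
  {ae (P \x P)%E, forall z, Q z} ->
  {ae (P \x P)%E, forall z, Q (z.2, z.1)}.
Proof.
move=> [N [mN N0 QN]].
have mN' : measurable ((fun z : T * T => (z.2, z.1)) @^-1` N).
  by rewrite -[X in measurable X]setTI; apply: measurable_swap.
exists ((fun z => (z.2, z.1)) @^-1` N); split=> //; last by move=> z; apply: QN.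
rewrite -N0 (product_measure_unique (m' := (P \x^ P)%E))//.
by move=> A B mA mB; rewrite -product_measure2E.
Qed.

Lemma ae_xsection (Q : T * T -> Prop) :
  {ae (P \x P)%E, forall z, Q z} ->
  {ae P, forall x, {ae P, forall y, Q (x, y)}}.
Proof.
move=> [N [mN N0 QN]].
have mP := measurable_fun_xsection P mN.
have /(ae_eq_integral_abs P measurableT mP) : (\int[P]_x `|(P \o xsection N) x|)%E = 0%E.
  rewrite -[RHS]N0; apply: eq_integral => x _.
  by rewrite gee0_abs.
apply: filterS => x /(_ I) /= Px0.
exists (xsection N x); split => //; first exact: measurable_xsection.
move=> y /= nQ; rewrite /xsection /= inE; exact: QN.
Qed.

Lemma ae_fst (A : T -> Prop) :
  {ae P, forall x, A x} -> {ae (P \x P)%E, forall z : T * T, A z.1}.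
Proof.
move=> [N [mN N0 AN]]; exists (N `*` setT); split.
- exact: measurableX.
- by rewrite product_measure1E//= N0 mul0e.
- by move=> z /= nA; split => //; apply: AN.
Qed.

Lemma probability_Rintegral_cst (v : R) : \int[P]_x v = v.
Proof.
by rewrite Rintegral_cst// [X in fine X](probability_setT P) mulr1.
Qed.

(** As [P] has mass 1, [v] is its own integral, so the difference is at most the integral of
    [|f - v|]. The same bound makes [f - v] integrable. *)
Lemma ae_close_Rintegral (f : T -> R) (v e : R) : measurable_fun setT f ->
  {ae P, forall x, `|f x - v| <= e} -> `|\int[P]_x f x - v| <= e.
Proof.
move=> mf fe.
(* A property that holds almost everywhere has a witness, because the total mass is positive. *)
have e0 : 0 <= e.
  have aeP : ProperFilter (almost_everywhere P).
    by apply: ae_properfilter_algebraOfSetsType; rewrite [ltRHS]probability_setT.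
  by have [x] := filter_ex fe; apply: le_trans.
have mg : measurable_fun setT (fun x => f x - v) by exact: measurable_funB.
have le_e : (\int[P]_x `|(f x - v)%:E| <= e%:E)%E.
  rewrite -[leRHS]mule1 -(probability_setT P) -integral_cst//.
  apply: ae_ge0_le_integral => //.
  - by do 2 apply: measurableT_comp => //.
  - by apply: filterS fe => x + _; rewrite lee_fin.
have ig : P.-integrable setT (EFin \o (fun x => f x - v)).
  apply/integrableP; split; first exact/measurable_EFinP.
  by apply: le_lt_trans le_e _; rewrite ltry.
have iv : P.-integrable setT (EFin \o cst v).
  exact: finite_measure_integrable_cst.
have -> : \int[P]_x f x = \int[P]_x ((f x - v) + cst v x).
  by apply: eq_Rintegral => x _ /=; rewrite subrK.
rewrite RintegralD// probability_Rintegral_cst addrK.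
apply: le_trans (le_normr_Rintegral measurableT ig) _.
rewrite -lee_fin fineK//.
rewrite ge0_fin_numE; last exact: integral_ge0.
by apply: le_lt_trans le_e _; rewrite ltry.
Qed.

End product_ae.

(** * The sup norm as an almost everywhere bound *)

Section Linfty.
Context (d : measure_display) (T : measurableType d) (R : realType).
Variable P : probability T R.

Lemma Linfty_normP (f : T * T -> R) (u : R) :
  (Linfty_norm P f <= u%:E)%E <-> {ae (P \x P)%E, forall z, `|f z| <= u}.
Proof.
(* The norm at [+oo] is an essential supremum when the whole space has positive measure. *)
rewrite /Linfty_norm unlock ifT; last first.
  by rewrite [ltRHS](probability_setT (_ : probability (T * T)%type R)).
split=> [/ess_supP fu|fu]; last apply/ess_supP.
  by apply: filterS fu => z /=; rewrite lee_fin.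
by apply: filterS fu => z /=; rewrite lee_fin.
Qed.
End Linfty.

(* Measurability of [g] for the product sigma-algebra on [I -> T], tested on
   measurable families of coordinates. *)
Definition family_measurable (d : measure_display) (T : measurableType d)
    (R : realType) (I : Type) (g : (I -> T) -> R) : Prop :=
  forall (d' : measure_display) (U : measurableType d') (f : I -> U -> T),
    (forall i, measurable_fun setT (f i)) ->
    measurable_fun setT (fun u => g (fun i => f i u)).

(** * Measurability and stability of iterated integrals *)

Section iterated_integral_theory.
Context (d : measure_display) (T : measurableType d) (R : realType).
Variable P : probability T R.

(** Tonelli applies to the positive and negative parts of [h] separately. *)
Lemma measurable_partial_Rintegral d' (U : measurableType d')
    (h : U * T -> R) : measurable_fun setT h ->
  measurable_fun setT (fun u => \int[P]_z h (u, z)).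
Proof.
move=> mh; apply: (measurableT_comp (fine_measurable measurableT)).
have mEh : measurable_fun setT (EFin \o h) by exact/measurable_EFinP.
rewrite (_ : (fun u => _) = fubini_F P (EFin \o h)^\+%E \- fubini_F P (EFin \o h)^\-%E)%E.
  apply: emeasurable_funB; apply: measurable_fun_fubini_tonelli_F => //.
    exact: measurable_funepos.
  exact: measurable_funeneg.
apply/funext => u; rewrite integralE /fubini_F.
by rewrite funepos.unlock funeneg.unlock.
Qed.

Lemma family_measurable_iterated_integral k (s : seq 'I_k)
    (g : ('I_k -> T) -> R) :
  family_measurable g -> family_measurable (iterated_integral P s g).
Proof.
move=> mg; elim: s => [//|i s IHs] d' U f mf /=.
(* The integrated coordinate joins the parameters: the induction hypothesis is used over [U * T],
   which is why [family_measurable] ranges over all parameter spaces. *)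
apply: (@measurable_partial_Rintegral _ _
  (fun uz => iterated_integral P s g (fun j => if j == i then uz.2 else f j uz.1))).
apply: (IHs _ _ (fun j uz => if j == i then uz.2 else f j uz.1)) => j.
case: (j == i); first exact: measurable_snd.
exact: (measurableT_comp (mf j) measurable_fst).
Qed.

Lemma family_measurable_edge_product k (F : simple_graph k) (W : T * T -> R) :
  measurable_fun setT W -> family_measurable (edge_product F W).
Proof.
move=> mW d' U f mf.
have mWf i j : measurable_fun setT (fun u => W (f i u, f j u)).
  exact: (measurableT_comp mW (measurable_fun_pair (mf i) (mf j))).
apply: measurable_prod => i _.
under eq_fun do rewrite big_mkcond/=.
apply: measurable_prod => j _; case: (i < j)%N => //.
by case: (_ \in _) => //; apply: measurable_funB.
Qed.

Lemma iterated_integral_cst k (s : seq 'I_k) (v : R) x :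
  iterated_integral P s (fun=> v) x = v.
Proof.
elim: s x => [//|i s IHs] x /=.
by under eq_Rintegral => z _ do rewrite IHs; rewrite probability_Rintegral_cst.
Qed.

(* Here [s] lists the coordinates still to be integrated.  The conditions on
   sections are what makes almost every value of the next coordinate generic
   too, so that an almost everywhere property [Q] of pairs can be carried
   through iterated integrals. *)
Definition generic (Q : T * T -> Prop) k (s : seq 'I_k) (x : 'I_k -> T) :=
  (forall i, i \notin s -> {ae P, forall y, Q (x i, y)} /\
                         {ae P, forall y, Q (y, x i)}) /\
  (forall i j, i \notin s -> j \notin s -> i != j -> Q (x i, x j)).

Lemma ae_generic (Q : T * T -> Prop) : {ae (P \x P)%E, forall z, Q z} ->
  {ae P, forall x, {ae P, forall y, Q (x, y)} /\ {ae P, forall y, Q (y, x)}}.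
Proof.
move=> QP; have := ae_xsection (ae_swap QP); have := ae_xsection QP.
by apply: filterS2 => x.
Qed.

Lemma generic_update (Q : T * T -> Prop) k i (s : seq 'I_k) x :
  {ae (P \x P)%E, forall z, Q z} -> generic Q (i :: s) x ->
  {ae P, forall z, generic Q s (fun j => if j == i then z else x j)}.
Proof.
move=> QP [gen1 gen2].
(* There are finitely many coordinates [j], so their exceptional null sets can be merged. *)
have aej : {ae P, forall z, forall j, j \notin i :: s -> Q (x j, z) /\ Q (z, x j)}.
  apply: filter_forall => j; case: (boolP (j \in i :: s)) => [_|js].
    by apply: filterE.
  by have [] := gen1 _ js; apply: filterS2 => z Q1 Q2.
apply: filterS2 aej (ae_generic QP) => z aej Qz; split=> [j js|j l js ls jl].
  by case: eqVneq => // ji; apply: gen1; rewrite inE negb_or ji.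
case: (eqVneq j i) jl => [->|ji] jl; case: (eqVneq l i) jl => [li|li] jl //.
- by have [] := aej l; rewrite // inE negb_or li.
- by have [] := aej j; rewrite // inE negb_or ji.
- by apply: gen2 => //; rewrite inE negb_or ?ji ?li.
Qed.

Lemma iterated_integral_close (Q : T * T -> Prop) k (s : seq 'I_k)
    (g : ('I_k -> T) -> R) (v e : R) x :
  {ae (P \x P)%E, forall z, Q z} -> family_measurable g ->
  (forall y, generic Q [::] y -> `|g y - v| <= e) ->
  generic Q s x -> `|iterated_integral P s g x - v| <= e.
Proof.
move=> QP mg ge; elim: s x => [|i s IHs] x gx /=; first exact: ge.
apply: ae_close_Rintegral.
  apply: (@family_measurable_iterated_integral _ s _ mg _ _
    (fun j z => if j == i then z else x j)) => j.
  by case: (j == i).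
by apply: filterS (generic_update QP gx) => z; apply: IHs.
Qed.

Lemma T_op_close (Q : T * T -> Prop) k (F : simple_graph k) (W : T * T -> R)
    (a b : 'I_k) (v e : R) :
  a != b -> {ae (P \x P)%E, forall z, Q z} -> measurable_fun setT W ->
  (forall y, generic Q [::] y -> `|edge_product F W y - v| <= e) ->
  {ae (P \x P)%E, forall z, `|T_op P F a b W z - v| <= e}.
Proof.
move=> ab QP mW We.
(* Only [a] and [b] are left unintegrated, so the base point is generic as soon as both entries of
   [z] have good sections and [Q] holds at [z] and at its swap. *)
have gen1 := ae_fst (ae_generic QP); have gen2 := ae_swap gen1.
apply: filterS2 (filterI gen1 gen2) (filterI QP (ae_swap QP)).
move=> [z1 z2] /= [g1 g2] [Q1 Q2].
rewrite /T_op.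
apply: (iterated_integral_close QP (family_measurable_edge_product F mW)) => //.
have notin i : i \notin [seq i <- enum 'I_k | i \notin [:: a; b]] ->
    i = a \/ i = b.
  rewrite mem_filter mem_enum andbT negbK !inE.
  by case/orP => /eqP; [left|right].
have ba : b == a = false by rewrite eq_sym (negbTE ab).
split=> [i /notin[]->|i j /notin[]-> /notin[]->]; by rewrite ?eqxx ?ba.
Qed.

End iterated_integral_theory.

(** * Lipschitz bounds for products over pairs of vertices *)

Section Lipschitz.
Context (d : measure_display) (T : measurableType d) (R : realType).

(** Telescoping: the factors are exchanged one at a time, each exchange costing at most [u] times a
    power of [B]. *)
Lemma prodr_lipschitz (I : Type) (r : seq I) (f g : I -> R) (B u : R) :
  1 <= B -> 0 <= u ->
  (forall i, `|f i| <= B) -> (forall i, `|g i| <= B) ->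
  (forall i, `|f i - g i| <= u) ->
  `|\prod_(i <- r) f i - \prod_(i <- r) g i| <= (size r)%:R * B ^+ size r * u.
Proof.
move=> B1 u0 fB gB fgu; have B0 : 0 <= B by apply: le_trans B1.
elim: r => [|i r IHr]; first by rewrite !big_nil subrr normr0 !mul0r.
have gr : `|\prod_(j <- r) g j| <= B ^+ size r.
  elim: r {IHr} => [|j r IHr]; first by rewrite big_nil normr1.
  by rewrite big_cons normrM exprS ler_pM.
rewrite !big_cons /=.
have -> : f i * \prod_(j <- r) f j - g i * \prod_(j <- r) g j =
  f i * (\prod_(j <- r) f j - \prod_(j <- r) g j) +
  (f i - g i) * \prod_(j <- r) g j by ring.
have Br : B ^+ size r <= B ^+ (size r).+1 by rewrite ler_weXn2l.
have -> : (size r).+1%:R * B ^+ (size r).+1 * u =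
  B * ((size r)%:R * B ^+ size r * u) + u * B ^+ (size r).+1.
  by rewrite exprS -natr1; ring.
apply: le_trans (ler_normD _ _) _; rewrite !normrM; apply: lerD.
  by apply: ler_pM.
by apply: ler_pM => //; apply: le_trans Br.
Qed.

(** Padding with factors 1 turns the double product into a single one of fixed length, the form to
    which the telescoping bound applies. *)
Lemma edge_productE (k : nat) (F : simple_graph k) (W : T * T -> R)
    (x : 'I_k -> T) :
  edge_product F W x = \prod_(p : 'I_k * 'I_k)
    (if (p.1 < p.2)%N then
       if [set p.1; p.2]%SET \in edges F then W (x p.1, x p.2)
       else 1 - W (x p.1, x p.2)
     else 1).
Proof.
rewrite /edge_product -(pair_bigA _ (fun i j : 'I_k => if (i < j)%N then
  if [set i; j]%SET \in edges F then W (x i, x j) else 1 - W (x i, x j)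
  else 1)) /=.
by apply: eq_bigr => i _; rewrite big_mkcond.
Qed.

Lemma edge_product_lipschitz (k : nat) (c M : R) : 0 <= c <= 1 ->
  exists2 K, 0 <= K & forall (F : simple_graph k) (W : T * T -> R) u x,
    0 <= u <= M ->
    (forall i j, i != j -> `|W (x i, x j) - c| <= u) ->
    `|edge_product F W x - edge_product F (cst c) x| <= K * u.
Proof.
move=> /andP[c0 c1].
(* Every factor is within [u <= |M|] of [c], [1 - c] or 1, all in [0, 1], so [B] bounds it. *)
pose B := 1 + `|M|; pose n := size (index_enum ('I_k * 'I_k)%type).
have B1 : 1 <= B by rewrite lerDl.
exists (n%:R * B ^+ n).
  by rewrite mulr_ge0// exprn_ge0// (le_trans _ B1).
move=> F W u x /andP[u0 uM] Wc.
have uM' : u <= `|M| by rewrite (le_trans uM)// ler_norm.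
rewrite !edge_productE; apply: prodr_lipschitz => // -[i j] /=;
  case: ifP => [ij|_]; rewrite ?normr1 ?subrr ?normr0//;
  case: ifP => _ /=; rewrite ler_norml /B; try (apply/andP; split; lra);
  have := Wc i j; rewrite neq_ltn ij => /(_ isT); rewrite ler_norml => /andP[? ?];
  apply/andP; split; lra.
Qed.

End Lipschitz.

(** * The velocity at constants: its polynomial, a root, and a Lipschitz bound *)

Section velocity_theory.
Context (d : measure_display) (T : measurableType d) (R : realType).
Variable P : probability T R.
Context (k : nat) (rule : simple_graph k -> simple_graph k -> R).

(** At [c] in [0, 1] this is the probability that the random graph on [k] labelled vertices with
    edge probability [c] equals [F]. *)
Definition edge_poly (F : simple_graph k) : {poly R} :=
  \prod_(i < k) \prod_(j < k | (i < j)%N)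
    (if [set i; j]%SET \in edges F then 'X else 1 - 'X)%R.

Lemma edge_product_cst (F : simple_graph k) (c : R) :
  edge_product F (cst c) = fun _ : 'I_k -> T => (edge_poly F).[c].
Proof.
apply/funext => x; rewrite /edge_product /edge_poly horner_prod.
apply: eq_bigr => i _; rewrite horner_prod; apply: eq_bigr => j _.
by case: ifP => _; rewrite !hornerE.
Qed.

Definition velocity_poly : {poly R} :=
  \sum_(F : simple_graph k) \sum_(H : simple_graph k) (rule F H)%:P *
    \sum_(a < k) \sum_(b < k | a != b)
      edge_poly F *
      (([set a; b]%SET \in edges H :\: edges F)%:R
       - ([set a; b]%SET \in edges F :\: edges H)%:R).

Lemma T_op_cst (F : simple_graph k) a b (c : R) z :
  T_op P F a b (cst c) z = (edge_poly F).[c].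
Proof. by rewrite /T_op edge_product_cst iterated_integral_cst. Qed.

Lemma horner_velocity_poly (c : R) : velocity_poly.[c] =
  \sum_(F : simple_graph k) \sum_(H : simple_graph k) rule F H *
    \sum_(a < k) \sum_(b < k | a != b) (edge_poly F).[c] *
      (([set a; b]%SET \in edges H :\: edges F)%:R
       - ([set a; b]%SET \in edges F :\: edges H)%:R).
Proof.
rewrite /velocity_poly horner_sum; apply: eq_bigr => F _.
rewrite horner_sum; apply: eq_bigr => H _; rewrite hornerM hornerC.
congr (_ * _); rewrite horner_sum; apply: eq_bigr => a _.
rewrite horner_sum; apply: eq_bigr => b _.
by rewrite hornerM hornerD hornerN -!polyC_natr !hornerC.
Qed.

Lemma velocity_cst (c : R) z : velocity P rule (cst c) z = velocity_poly.[c].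
Proof.
rewrite horner_velocity_poly; apply: eq_bigr => F _; apply: eq_bigr => H _.
by congr (_ * _); apply: eq_bigr => a _; apply: eq_bigr => b _; rewrite T_op_cst.
Qed.

Lemma horner_edge_poly0 (F : simple_graph k) (a b : 'I_k) : a != b ->
  [set a; b]%SET \in edges F -> (edge_poly F).[0] = 0.
Proof.
wlog ab : a b / (a < b)%N => [wl|_ abF].
  by rewrite neq_ltn => /orP[] ?; [|rewrite finset.setUC]; apply: wl => //;
    rewrite neq_ltn; apply/orP; auto.
rewrite /edge_poly (bigD1 a)//= (bigD1 b)//= abF.
by rewrite !hornerM hornerX !mul0r.
Qed.

Lemma horner_edge_poly1 (F : simple_graph k) (a b : 'I_k) : a != b ->
  [set a; b]%SET \notin edges F -> (edge_poly F).[1] = 0.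
Proof.
wlog ab : a b / (a < b)%N => [wl|_ /negbTE abF].
  by rewrite neq_ltn => /orP[] ?; [|rewrite finset.setUC]; apply: wl => //;
    rewrite neq_ltn; apply/orP; auto.
rewrite /edge_poly (bigD1 a)//= (bigD1 b)//= abF.
by rewrite !hornerM !hornerE subrr !mul0r.
Qed.

Lemma velocity_poly_root : is_rule rule ->
  exists2 c, 0 <= c <= 1 & root velocity_poly c.
Proof.
move=> [rule01 _]; have rule0 F H : 0 <= rule F H by case/andP: (rule01 F H).
have poly01 (F : simple_graph k) x : 0 <= x <= 1 -> 0 <= (edge_poly F).[x].
  move=> /andP[x0 x1]; rewrite horner_prod; apply: prodr_ge0 => i _.
  rewrite horner_prod; apply: prodr_ge0 => j _.
  by case: ifP => _; rewrite !hornerE// subr_ge0.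
(* The polynomial is negated because [poly_ivt] expects a value that is nonpositive at the left end
   and nonnegative at the right end. *)
have [c c01 /eqP] : exists2 c, 0 <= c <= 1 & root (- velocity_poly) c.
  apply: poly_ivt => //; rewrite !hornerN oppr_le0 oppr_ge0 !horner_velocity_poly.
  apply/andP; split.
    apply: sumr_ge0 => F _; apply: sumr_ge0 => H _; apply: mulr_ge0 => //.
    apply: sumr_ge0 => a _; apply: sumr_ge0 => b ab.
    have [abF|abF] := boolP ([set a; b]%SET \in edges F).
      by rewrite (horner_edge_poly0 ab abF) mul0r.
    by rewrite !finset.in_setD (negbTE abF) andbF subr0 mulr_ge0// poly01 ?lexx ?ler01.
  apply: sumr_le0 => F _; apply: sumr_le0 => H _; apply: mulr_ge0_le0 => //.
  apply: sumr_le0 => a _; apply: sumr_le0 => b ab.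
  have [abF|abF] := boolP ([set a; b]%SET \in edges F).
    by rewrite !finset.in_setD abF sub0r mulrN oppr_le0 mulr_ge0// poly01 ?lexx ?ler01.
  by rewrite (horner_edge_poly1 ab abF) mul0r.
by rewrite hornerN => /eqP; rewrite oppr_eq0 => /eqP pc; exists c => //; apply/eqP.
Qed.

Lemma velocity_lipschitz (c M : R) : 0 <= c <= 1 ->
  exists2 K, 0 <= K & forall (W : T * T -> R) u,
    measurable_fun setT W -> 0 <= u <= M ->
    {ae (P \x P)%E, forall z, `|W z - c| <= u} ->
    {ae (P \x P)%E, forall z,
      `|velocity P rule W z - velocity P rule (cst c) z| <= K * u}.
Proof.
move=> c01; have [K K0 KP] := @edge_product_lipschitz _ T R k c M c01.
pose I (F H : simple_graph k) (a b : 'I_k) : R :=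
  ([set a; b]%SET \in edges H :\: edges F)%:R
   - ([set a; b]%SET \in edges F :\: edges H)%:R.
exists (\sum_(F : simple_graph k) \sum_(H : simple_graph k) `|rule F H| *
    \sum_(a < k) \sum_(b < k | a != b) K * `|I F H a b|).
  apply: sumr_ge0 => F _; apply: sumr_ge0 => H _; apply: mulr_ge0 => //.
  by apply: sumr_ge0 => a _; apply: sumr_ge0 => b _; apply: mulr_ge0.
move=> W u mW uM Wc.
(* One null set serves all of the finitely many [F], [a], [b], and integration keeps the constant
   [K] of the edge products. *)
have Tae : {ae (P \x P)%E, forall z, forall (F : simple_graph k) (a b : 'I_k),
    a != b -> `|T_op P F a b W z - T_op P F a b (cst c) z| <= K * u}.
  apply: filter_forall => F; apply: filter_forall => a; apply: filter_forall => b.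
  have [ab|ab] := boolP (a != b); last exact: filterE.
  have Fc y : generic P (fun z => `|W z - c| <= u) [::] y ->
      `|edge_product F W y - (edge_poly F).[c]| <= K * u.
    move=> [_ gy]; have -> : (edge_poly F).[c] = edge_product F (cst c) y.
      by rewrite edge_product_cst.
    by apply: KP => // i j; apply: gy.
  by apply: filterS (T_op_close ab Wc mW Fc) => z + _; rewrite T_op_cst.
apply: filterS Tae => z Tz.
rewrite /velocity -sumrB mulr_suml; apply: le_trans (ler_norm_sum _ _ _) _.
apply: ler_sum => F _.
rewrite -sumrB mulr_suml; apply: le_trans (ler_norm_sum _ _ _) _.
apply: ler_sum => H _.
rewrite -mulrBr normrM -mulrA ler_wpM2l//.
rewrite -sumrB mulr_suml; apply: le_trans (ler_norm_sum _ _ _) _.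
apply: ler_sum => a _.
rewrite -sumrB mulr_suml; apply: le_trans (ler_norm_sum _ _ _) _.
apply: ler_sum => b ab.
by rewrite -mulrBl normrM mulrAC ler_wpM2r// Tz.
Qed.

End velocity_theory.

(** * A Gronwall argument by barriers *)

Section Gronwall.
Context (R : realType).

(* The hypothesis on [D] gives continuity at [t] when applied with [M := D t].
   Applied with [M := 1] it bounds the growth rate by [K * D t] while [D t <= 1],
   which keeps [D] below every barrier [e0 * expR ((K + 1) * (t - b))] with
   [e0 <= 1]. *)
Lemma gronwall_eq0 (J : set R) (D : R -> R) :
  is_interval J -> J 0 -> D 0 = 0 -> (forall t, J t -> 0 <= D t) ->
  (forall M, exists2 K, 0 <= K & forall t, J t -> D t <= M ->
    forall e, 0 < e -> exists2 del, 0 < del & forall h, `|h| < del ->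
      `|D (t + h) - D t| <= `|h| * (K * D t + e)) ->
  forall b, 0 <= b -> J b -> D b = 0.
Proof.
move=> Jint J0 D0 Dge0 HD b b0 Jb.
have [K K0 HK] := HD 1.
suff small e0 : 0 < e0 -> e0 <= 1 -> D b <= e0.
  apply/eqP; rewrite eq_le Dge0// andbT leNgt; apply/negP => Db.
  have := small (Num.min 1 (D b / 2)).
  rewrite lt_min ltr01 divr_gt0// ge_min lexx => /(_ isT isT).
  rewrite le_min => /andP[_]; lra.
move=> e00 e01.
pose B t := e0 * expR ((K + 1) * (t - b)).
have B0 t : 0 < B t by rewrite mulr_gt0// expR_gt0.
have Bb : B b = e0 by rewrite /B subrr mulr0 expR0 mulr1.
have Bmono s t : s <= t -> B s <= B t.
  move=> st; rewrite ler_pM2l// ler_expR ler_wpM2l//; last by rewrite lerD2r.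
  by rewrite addr_ge0.
(* The exponential lies above its tangent, by [1 + x <= expR x]. *)
have Bstep s h : 0 <= h -> B s + h * ((K + 1) * B s) <= B (s + h).
  move=> h0; rewrite /B.
  have -> : (K + 1) * (s + h - b) = (K + 1) * (s - b) + (K + 1) * h by ring.
  rewrite expRD; set E := expR ((K + 1) * (s - b)).
  have E0 : 0 < E by exact: expR_gt0.
  have := expR_ge1Dx ((K + 1) * h) => /(ler_wpM2l (ltW (mulr_gt0 e00 E0))).
  nra.
rewrite -Bb leNgt; apply/negP => DbB.
pose E := [set t | 0 <= t <= b /\ B t < D t].
have Eb : E b by split=> //; rewrite b0 lexx.
have Elb : lbound E 0 by move=> t [/andP[]].
have infE : has_inf E by split; [exists b | exists 0].
(* The time [s] is where [D] first crosses the barrier. *)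
pose s := inf E.
have s0 : 0 <= s by apply: lb_le_inf => //; exists b.
have sb : s <= b by apply: ge_inf => //; exists 0.
have Js : J s by apply: (Jint 0 b) => //; rewrite s0 sb.
have DB t : 0 <= t -> t < s -> D t <= B t.
  move=> t0 ts; rewrite leNgt; apply/negP => BD.
  have : s <= t.
    by apply: ge_inf; [exists 0 | split=> //; rewrite t0 (ltW (lt_le_trans ts sb))].
  by rewrite leNgt ts.
have DsB : D s <= B s.
  rewrite leNgt; apply/negP => BsD.
  have sgt0 : 0 < s.
    rewrite lt_neqAle s0 andbT; apply/eqP => s_eq0.
    by move: BsD; rewrite -s_eq0 D0 ltNge (ltW (B0 _)).
  have [L L0 /(_ s Js (lexx _) 1 ltr01)[del del0 Hdel]] := HD (D s).
  pose C := L * D s + 1.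
  have C0 : 0 < C by rewrite ltr_wpDl// mulr_ge0// Dge0.
  (* Going back by [h] changes [D] by at most half of the gap [D s - B s], so [D] would still exceed
     the barrier before [s]. *)
  pose h := Num.min (Num.min (del / 2) s) ((D s - B s) / (2 * C)).
  have h0 : 0 < h by rewrite !lt_min sgt0 !divr_gt0// ?subr_gt0// mulr_gt0.
  have hdel : h <= del / 2 by rewrite !ge_min lexx.
  have hs : h <= s by rewrite !ge_min lexx orbT.
  have hC : h * C <= (D s - B s) / 2.
    rewrite -ler_pdivlMr// -mulrA -invfM.
    by rewrite ge_min lexx orbT.
  have := Hdel (- h); rewrite normrN gtr0_norm// => /(_ ltac:(lra)).
  rewrite -/C ler_norml => /andP[lo _].
  have sh : s - h < s by lra.
  have := DB (s - h); rewrite subr_ge0 => /(_ hs sh) Dh.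
  have := Bmono _ _ (ltW sh).
  lra.
have Bs1 : B s <= 1 by rewrite (le_trans (Bmono _ _ sb))// Bb.
(* The error [B s] makes the growth rate at most [(K + 1) * B s], that of the barrier, so [D] cannot
   cross within [del] after [s]. Yet [E] has points there. *)
have [del del0 Hdel] := HK s Js (le_trans DsB Bs1) (B s) (B0 s).
have [t Et ts] := inf_adherent del0 infE.
have st : s <= t by apply: ge_inf => //; exists 0.
have [_] := Et; apply/negP; rewrite -leNgt.
have -> : t = s + (t - s) by ring.
apply: le_trans (Bstep _ _ _); last by rewrite subr_ge0.
have ht : `|t - s| = t - s by rewrite ger0_norm// subr_ge0.
have := Hdel (t - s); rewrite ht => /(_ ltac:(by rewrite ltrBlDl)).
rewrite ler_norml => /andP[_].
have t0 : 0 <= t - s by rewrite subr_ge0.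
have : (t - s) * (K * D s) <= (t - s) * (K * B s).
  by rewrite ler_wpM2l// ler_wpM2l.
have : 0 <= (t - s) * (K * B s) by rewrite !mulr_ge0// ltW.
rewrite -/s; nra.
Qed.
End Gronwall.

(** * The constant solution and its uniqueness *)

Section constant_trajectory.
Context (d : measure_display) (T : measurableType d) (R : realType).
Variable P : probability T R.
Context (k : nat) (rule : simple_graph k -> simple_graph k -> R).

Lemma is_graphon_cst (c : R) : 0 <= c <= 1 -> is_graphon P (cst c).
Proof.
move=> c01; split; last exact: filterE.
by split=> //; [exists `|c| | exact: filterE].
Qed.

Lemma is_solution_cst (c : R) : (forall z, velocity P rule (cst c) z = 0) ->
  0 <= c <= 1 -> is_solution P rule (cst c) [set: R] (fun=> cst c).
Proof.
move=> vc c01; split=> //.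
- by split=> //; exact: openT.
- by move=> t _; case: (is_graphon_cst c01).
- exact: filterE.
move=> t _; rewrite (_ : (fun h => _) = cst 0%E); first exact: cvg_cst.
apply/funext => h; rewrite /Linfty_norm -[RHS](@Lnorm0 _ _ _ (P \x P)%E +oo%E)//.
by apply: eq_Lnorm => z /=; rewrite vc subrr mulr0 subr0.
Qed.

Lemma solution_cst_unique (c : R) (J : set R) (psi : R -> T * T -> R) :
  (forall z, velocity P rule (cst c) z = 0) -> 0 <= c <= 1 ->
  is_solution P rule (cst c) J psi ->
  forall t, J t -> psi t = cst c %[ae (P \x P)%E].
Proof.
move=> vc c01 [[Jopen Jint J0] kerpsi psi0 dpsi].
pose N t := Linfty_norm P (fun z => psi t z - c).
(* [fine] sends an infinite norm to 0, but for [t] in [J] the norm is finite because kernels are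
   bounded. *)
pose D t := fine (N t).
have N0 t : (0 <= N t)%E by exact: Lnorm_ge0.
have Dge0 t : 0 <= D t by exact: fine_ge0.
have NfinD t : J t -> N t = (D t)%:E.
  move=> /kerpsi[_ [M psiM] _]; rewrite fineK// ge0_fin_numE//.
  apply: (@le_lt_trans _ _ (M + `|c|)%:E); last exact: ltry.
  apply/Linfty_normP/filterE => z.
  by rewrite (le_trans (ler_normB _ _))// lerD2r.
have aeD t : J t -> {ae (P \x P)%E, forall z, `|psi t z - c| <= D t}.
  by move=> Jt; apply/Linfty_normP; rewrite -/(N t) NfinD.
have D_le t u : J t -> {ae (P \x P)%E, forall z, `|psi t z - c| <= u} -> D t <= u.
  by move=> Jt /Linfty_normP; rewrite -/(N t) NfinD// lee_fin.
have D0 : D 0 = 0.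
  apply/eqP; rewrite eq_le Dge0 andbT; apply: D_le => //.
  by apply: filterS psi0 => z /(_ I) ->; rewrite subrr normr0.
have step M : exists2 K, 0 <= K & forall t, J t -> D t <= M ->
    forall e, 0 < e -> exists2 del, 0 < del & forall h, `|h| < del ->
      `|D (t + h) - D t| <= `|h| * (K * D t + e).
  have [K K0 KP] := velocity_lipschitz P rule M c01; exists K => //.
  move=> t Jt DM e e0.
  have vel : {ae (P \x P)%E, forall z, `|velocity P rule (psi t) z| <= K * D t}.
    have [mpsi _ _] := kerpsi _ Jt.
    have := KP _ (D t) mpsi; rewrite Dge0 DM => /(_ isT (aeD _ Jt)).
    by apply: filterS => z; rewrite vc subr0.
  have /fine_cvgP[Lfin /cvgr0_norm_lt/(_ e e0) Lsmall] := dpsi _ Jt.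
  have : \forall h \near (0 : R)^', `|h| != 0 /\
      {ae (P \x P)%E, forall z, `|h^-1 * (psi (t + h) z - psi t z)
                                 - velocity P rule (psi t) z| <= e}.
    near=> h; split; first by rewrite normr_eq0; near: h; exact: nbhs_dnbhs_neq.
    apply/Linfty_normP; rewrite -[leLHS]fineK; last by near: h.
    by rewrite lee_fin (le_trans (ler_norm _))// ltW//; near: h.
  rewrite /dnbhs => /nbhs_ballP[d1 /= d10 Hd1].
  have /nbhs_ballP[d2 /= d20 Hd2] := open_nbhs_nbhs (conj Jopen Jt).
  exists (Num.min d1 d2); first by rewrite lt_min d10.
  move=> h; rewrite lt_min => /andP[hd1 hd2].
  have [->|h0] := eqVneq h 0; first by rewrite addr0 subrr normr0 mul0r.
  have Jth : J (t + h).
    by apply: Hd2; rewrite /ball/= opprD addrA subrr sub0r normrN.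
  have [_ quot] : `|h| != 0 /\ _ := Hd1 h ltac:(by rewrite /ball/= sub0r normrN) h0.
  (* The increment of [psi] is [h] times the quotient error, at most [e], plus the velocity, at most
     [K * D t]. *)
  have diff : {ae (P \x P)%E, forall z,
      `|psi (t + h) z - psi t z| <= `|h| * (K * D t + e)}.
    apply: filterS2 quot vel => z q v.
    have -> : psi (t + h) z - psi t z = h * (h^-1 * (psi (t + h) z - psi t z)
        - velocity P rule (psi t) z + velocity P rule (psi t) z).
      by rewrite subrK mulrA divff// mul1r.
    rewrite normrM ler_wpM2l// (le_trans (ler_normD _ _))// addrC.
    exact: lerD.
  rewrite ler_norml; apply/andP; split.
    rewrite lerBrDr addrC lerBlDr.
    apply: D_le => //; apply: filterS2 (aeD _ Jth) diff => z p q.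
    rewrite (_ : psi t z - c = (psi (t + h) z - c) - (psi (t + h) z - psi t z)).
      by rewrite (le_trans (ler_normB _ _))// lerD.
    by ring.
  rewrite lerBlDl; apply: D_le => //; apply: filterS2 (aeD _ Jt) diff => z p q.
  rewrite (_ : psi (t + h) z - c = (psi t z - c) + (psi (t + h) z - psi t z)).
    by rewrite (le_trans (ler_normD _ _))// lerD.
  by ring.
have Dt0 t : J t -> D t = 0.
  move=> Jt; have [t0|/ltW t0] := leP 0 t.
    exact: (gronwall_eq0 Jint J0 D0 (fun t _ => Dge0 t) step).
  (* Negative times follow by time reversal: the step estimate is symmetric in the sign of [h]. *)
  rewrite -(opprK t).
  apply: (@gronwall_eq0 _ (-%R @^-1` J) (D \o -%R)) => //=.
  - move=> x y /= Jx Jy z /andP[xz zy]; apply: (Jint _ _ Jy Jx).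
    by rewrite !lerN2 xz zy.
  - by rewrite oppr0.
  - by rewrite oppr0.
  - move=> M; have [K K0 HK] := step M; exists K => // s Js Ds e e0.
    have [del del0 Hdel] := HK _ Js Ds _ e0; exists del => // h hdel.
    by rewrite opprD -(normrN h) Hdel ?normrN.
  - by rewrite oppr_ge0.
  - by rewrite opprK.
move=> t Jt; apply: filterS (aeD _ Jt) => z + _.
by rewrite Dt0// normr_le0 subr_eq0 => /eqP.
Unshelve. all: by end_near. Qed.

End constant_trajectory.

(** * Existence of a constant fixed point *)

Theorem proposition6p10 (d : measure_display) (T : measurableType d)
    (R : realType) (P : probability T R)
    (P_atomless : atomless P) (P_separable : separable_sigma_algebra P)
    (k : nat) (rule : simple_graph k -> simple_graph k -> R)
    (rule_ok : is_rule rule) :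
  exists W : T * T -> R,
    [/\ is_graphon P W,
        velocity P rule W = cst 0 %[ae (P \x P)%E] &
        is_fixed_point P rule W].
Proof.
have [c c01 /eqP pc] := velocity_poly_root rule_ok.
have vc z : velocity P rule (cst c) z = 0 by rewrite velocity_cst.
have Wc := is_graphon_cst P c01.
exists (cst c); split=> //; first exact: filterE.
split=> //; exists (fun=> cst c); last by move=> t; exact: filterE.
split; first exact: is_solution_cst.
move=> J psi sol; split=> // t Jt.
exact: (solution_cst_unique vc c01 sol).
Qed.
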